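(* Let $\eta_1,\dots,\eta_N$ be independent with $\eta_i\sim\mathbb{P}_i$, where the scenario-generating probability measures $\mathbb{P}_1,\dots,\mathbb{P}_{N+1}$ on $\Delta$ follow Model A with parameter $\rho$, i.e. $d_{\mathrm W}(\mathbb{P}_i,\mathbb{P}_j)\le\rho$ for all indices $i,j\ge 1$. Let $\mathcal{S}=\{\eta_1,\dots,\eta_N\}$ and let $\epsilon\in(0,1)$. Suppose Assumption 1 (feasibility, non-empty interior, uniqueness) and Assumption 2 (convexity), both stated in the context, hold. Let $x^*_{\mathcal{RS}}$ be the optimal solution of the robust scenario problem $\mathrm{RSP}(\mathcal{S})$ with radii $r_1,\dots,r_N>0$, let $r_{\min}=\min_{1\le i\le N} r_i$, and let $d$ be the dimension of the decision variable $x$. Then $$\Big(\prod_{i=1}^N\mathbb{P}_i\Big)\big(\mathbb{V}_{N+1}(x^*_{\mathcal{RS}})>\epsilon\big)<\binom{N}{d}\exp\Big(\frac{\rho\,(N+1-d)}{r_{\min}}-\epsilon\Big).$$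
   Context: Let $\Delta$ be an uncertainty set in a normed space with norm $\|\cdot\|$. The decision variable $x$ lies in a Euclidean space $\mathbb{R}^d$, $c$ is a fixed cost vector in that space, $f(x,\xi)$ is the random constraint function ($\xi\in\Delta$), and $g(x)\le 0$ is the deterministic constraint. Put $\chi=\{x: g(x)\le 0\}$ and $\mathcal{X}_\xi=\{x: f(x,\xi)\le 0\}$. For $\eta\in\Delta$ and $r>0$ put $\mathcal{X}^{r}_{\eta}=\{x:\max_{\|\xi-\eta\|\le r} f(x,\xi)\le 0\}$. Given scenarios $\mathcal{S}=\{\eta_1,\dots,\eta_N\}$ and radii $r_1,\dots,r_N>0$, the scenario problem is $\mathrm{SP}(\mathcal{S}):\ \min_{x\in\chi} c^\top x$ subject to $x\in\bigcap_{i=1}^N\mathcal{X}_{\eta_i}$, and the robust scenario problem is $\mathrm{RSP}(\mathcal{S}):\ \min_{x\in\chi} c^\top x$ subject to $x\in\bigcap_{i=1}^N\mathcal{X}^{r_i}_{\eta_i}$. Violation probability: $\mathbb{V}_i(x)=\mathbb{P}_i(x\notin\mathcal{X}_\xi)$, the probability being over $\xi\sim\mathbb{P}_i$ with $x$ fixed. Thus $\mathbb{V}_{N+1}(x^*_{\mathcal{RS}})$ is a random variable depending on $(\eta_1,\dots,\eta_N)$, and $\prod_{i=1}^N\mathbb{P}_i$ denotes the product measure, i.e. the law of $(\eta_1,\dots,\eta_N)$. 1-Wasserstein distance: $d_{\mathrm W}(\mathbb{P},\mathbb{P}')=\inf_{\pi\in\Pi(\mathbb{P},\mathbb{P}')}\int\|\xi-\xi'\|\,\pi(d\xi,d\xi')$,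 where $\Pi(\mathbb{P},\mathbb{P}')$ is the set of joint distributions with marginals $\mathbb{P}$ and $\mathbb{P}'$. Assumption 1: for all sampled scenarios $\mathcal{S}$, the problems $\mathrm{SP}(\mathcal{S})$ and $\mathrm{RSP}(\mathcal{S})$ are feasible, their feasible regions have non-empty interior, and each such problem has a unique solution. Assumption 2: the deterministic constraint $g(x)\le 0$ is convex, and $f(x,\xi)$ is convex in $x$ for every $\xi$.
   Formalization: Proved for N > d: for N < d the bound is 0, and for N = d the claim fails (e.g. d = 1, uniform law on [0,20], f = |x−ξ|−1). Measurability of f(x,·), of {η : x ∈ X^{r_i}_η} and of V_{N+1}(x*_RS) is assumed explicitly. *)

(* Defs.v *)
From HB Require Import structures.
From mathcomp Require Import all_boot all_order all_algebra.
From mathcomp Require Import all_classical all_reals all_analysis.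
From mathcomp Require Import measurable_realfun.

Set Implicit Arguments.
Unset Strict Implicit.
Unset Printing Implicit Defensive.

Import Order.TTheory GRing.Theory Num.Theory.
Import numFieldNormedType.Exports.

Local Open Scope classical_set_scope.
Local Open Scope ring_scope.

(* Declares T * U as a ptopologicalType; no new structure is introduced. *)
HB.instance Definition _ (T U : ptopologicalType) := Pointed.on (T * U)%type.

Definition borel (T : ptopologicalType) := g_sigma_algebraType (@open T).

(* [Delta] as a type of its own, with the subspace topology.  A measurableType
   is pointed, so the alias carries a proof that [Delta] is non-empty (which
   is automatic as soon as [Delta] carries a probability measure). *)
Definition uset (E : topologicalType) (Delta : set E)
  (Delta0 : Delta !=set0) : Type := set_type Delta.

Section uset_instances.
Context (E : topologicalType) (Delta : set E) (Delta0 : Delta !=set0).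

Definition uset_point : uset Delta0 :=
  let: exist x Dx := cid Delta0 in exist _ x (mem_set Dx).

HB.instance Definition _ := Topological.copy (uset Delta0) (set_type Delta).
HB.instance Definition _ := isPointed.Build (uset Delta0) uset_point.

End uset_instances.

Section product_measure.
Context d (T : measurableType d) (R : realType).

Definition tcons n (z : T * n.-tuple T) : n.+1.-tuple T :=
  [the n.+1.-tuple T of z.1 :: z.2].

Lemma measurable_tcons n : measurable_fun setT (@tcons n).
Proof. by apply: measurable_cons; [exact: measurable_fst|exact: measurable_snd]. Qed.

Section step.
Context n (P : probability T R) (Q : probability (n.-tuple T) R).

Definition prod_cons : set (n.+1.-tuple T) -> \bar R :=
  pushforward (P \x Q)%E (@tcons n).

Let prod_cons0 : prod_cons set0 = 0%E.
Proof. by rewrite /prod_cons /pushforward preimage_set0 measure0. Qed.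

Let prod_cons_ge0 A : (0 <= prod_cons A)%E.
Proof. by rewrite /prod_cons /pushforward measure_ge0. Qed.

Let prod_cons_sigma_additive : semi_sigma_additive prod_cons.
Proof.
move=> F mF tF mUF; rewrite /prod_cons /pushforward preimage_bigcup.
apply: measure_semi_sigma_additive.
- by move=> i; rewrite -[X in measurable X]setTI; exact: measurable_tcons.
- apply/trivIsetP => i j _ _ ij; rewrite -preimage_setI.
  by move/trivIsetP : tF => ->//; rewrite preimage_set0.
- rewrite -preimage_bigcup -[X in measurable X]setTI.
  exact: measurable_tcons.
Qed.

HB.instance Definition _ := isMeasure.Build _ _ _ prod_cons
  prod_cons0 prod_cons_ge0 prod_cons_sigma_additive.

Let prod_cons_setT : prod_cons setT = 1%E.
Proof. by rewrite /prod_cons /pushforward preimage_setT probability_setT. Qed.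

HB.instance Definition _ :=
  Measure_isProbability.Build _ _ _ prod_cons prod_cons_setT.

End step.

Fixpoint prod_probability n :
    ('I_n -> probability T R) -> probability (n.-tuple T) R :=
  match n with
  | 0 => fun=> \d_ [tuple]
  | n'.+1 => fun P => prod_cons (P ord0)
                        (prod_probability (fun i => P (lift ord0 i)))
  end.

Lemma prod_probabilityE n (P : 'I_n -> probability T R) (A : 'I_n -> set T) :
  (forall i, measurable (A i)) ->
  prod_probability P [set t | forall i, A i (tnth t i)] =
  (\prod_(i < n) P i (A i))%E.
Proof.
elim: n P A => [|n IHn] P A mA /=.
  by rewrite big_ord0 diracE mem_set//= => -[].
rewrite big_ord_recl -IHn//.
have -> : prod_cons (P ord0) (prod_probability (fun i => P (lift ord0 i)))
    [set t | forall i, A i (tnth t i)] =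
  (P ord0 \x prod_probability (fun i => P (lift ord0 i)))%E
    (A ord0 `*` [set t | forall i, A (lift ord0 i) (tnth t i)]).
  rewrite /prod_cons /pushforward; congr (_ _).
  apply/seteqP; split => -[x t] /=.
    move=> h; split; first by have := h ord0; rewrite tnth0.
    by move=> i; have := h (lift ord0 i); rewrite tnthS.
  move=> [h0 h] i; case: (unliftP ord0 i) => [j ->|->]; last by rewrite tnth0.
  by rewrite tnthS.
rewrite product_measure1E//.
have -> : [set t : n.-tuple T | forall i, A (lift ord0 i) (tnth t i)] =
    \bigcap_(i in [set: 'I_n]) ((@tnth n T)^~ i @^-1` A (lift ord0 i)).
  by apply/seteqP; split => t /= h; [move=> i _; exact: h|
    move=> i; exact: (h i I)].
apply: fin_bigcap_measurable => // i _.
by rewrite -[X in measurable X]setTI; exact: measurable_tnth.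
Qed.

End product_measure.

Section wasserstein.
Context (R : realType) (E : normedModType R) (Delta : set E)
  (Delta0 : Delta !=set0).
Local Notation D := (uset Delta0).

Definition udist (x y : Delta) : R := `|(set_val x : E) - (set_val y : E)|.

(* Joint laws live on the Borel sigma-algebra of the product space, for which
   [udist] is always measurable; it is the product sigma-algebra when [E]
   is separable. *)
Definition couplings (P Q : probability (borel D) R) :
    set (probability (borel (D * D)%type) R) :=
  [set pi | forall A : set (borel D), measurable A ->
     pi (A `*` setT) = P A /\ pi (setT `*` A) = Q A].

Definition wasserstein1 (P Q : probability (borel D) R) : \bar R :=
  ereal_inf [set (\int[pi]_z (udist z.1 z.2)%:E)%E | pi in couplings P Q].

End wasserstein.

Section scenario_programs.
Context (R : realType) (E : normedModType R) (Delta : set E)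
  (Delta0 : Delta !=set0) (d : nat).
Local Notation D := (borel (uset Delta0)).

Definition constraint_set (f : 'cV[R]_d -> D -> R) (xi : D) : set 'cV[R]_d :=
  [set x | f x xi <= 0].

(* The maximum is written as a supremum in the extended reals, so that its
   existence need not be assumed. *)
Definition robust_constraint_set (f : 'cV[R]_d -> D -> R) (r : R) (eta : D) :
    set 'cV[R]_d :=
  [set x | (ereal_sup [set (f x xi)%:E | xi in
              [set xi : D | (udist xi eta <= r)%R]] <= 0)%E].

Definition SP_region N (g : 'cV[R]_d -> R) (f : 'cV[R]_d -> D -> R)
    (eta : N.-tuple D) : set 'cV[R]_d :=
  [set x | g x <= 0] `&` \bigcap_i constraint_set f (tnth eta i).

Definition RSP_region N (g : 'cV[R]_d -> R) (f : 'cV[R]_d -> D -> R)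
    (r : 'I_N -> R) (eta : N.-tuple D) : set 'cV[R]_d :=
  [set x | g x <= 0] `&` \bigcap_i robust_constraint_set f (r i) (tnth eta i).

Definition objective (c x : 'cV[R]_d) : R := (c^T *m x) ord0 ord0.

Definition is_solution (c : 'cV[R]_d) (A : set 'cV[R]_d) (x : 'cV[R]_d) :=
  A x /\ forall y, A y -> objective c x <= objective c y.

Definition well_posed (c : 'cV[R]_d) (A : set 'cV[R]_d) :=
  [/\ A !=set0, A° !=set0 & exists! x, is_solution c A x].

Definition violation (P : probability D R) (f : 'cV[R]_d -> D -> R)
    (x : 'cV[R]_d) : \bar R :=
  P [set xi | ~ constraint_set f xi x].

End scenario_programs.

(* Main.v *)
Require Import Defs.
From mathcomp Require Import all_boot all_order all_algebra.
From mathcomp Require Import all_classical all_reals all_analysis.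
From mathcomp Require Import measurable_realfun.
From mathcomp Require Import ring lra.

Set Implicit Arguments.
Unset Strict Implicit.
Unset Printing Implicit Defensive.

Import Order.TTheory GRing.Theory Num.Theory.
Import numFieldNormedType.Exports.

Local Open Scope classical_set_scope.
Local Open Scope ring_scope.

(** Fix a set J of d scenarios.  If the optimal solution is already optimal for
    the relaxed problem that keeps only the robust constraints indexed by J,
    then it is a function of (eta_j), j in J.  Freeze these d scenarios: the
    solution becomes a fixed point x, and each of the N - d remaining
    independent scenarios has to be drawn so that x satisfies its robust
    constraint.  If x violates the constraint with P_{N+1}-probability more
    than eps, then scenario i does so with probability at most
    1 - eps + rho / r_i ([robust_violation_le]): a coupling of P_i and P_{N+1}
    of average cost at most rho moves at most a fraction rho / r_i of the mass
    further than r_i, and x satisfies the constraint at every point within r_i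
    of a scenario whose robust constraint it satisfies.  By
    Fubini ([prod_probability_le]), the event has probability at most
    (1 - eps + rho / r_min)^(N - d) for each J, and Helly's theorem provides
    such a J for every sample ([support_exists]).  Summing over the 'C(N, d)
    choices and using 1 + u <= exp u ([pow_lt_expR]) gives the bound; it is
    strict because eps > 0 and N > d.

    Two points need care.

    The relaxed problem attached to J can have several optimal solutions, and
    then the frozen scenarios do not determine x.  Ties are therefore broken by
    the Euclidean norm: [preferred c y x] says that y is cheaper than x, or not
    more expensive and strictly shorter.  The points preferred to x form a
    convex set, which is all that Helly's theorem requires, and a convex set
    has at most one point to which no other is preferred
    ([preferred_min_unique]).

    Fubini's theorem needs the event that J supports the solution to be
    measurable, although only the events that a given point x satisfies a
    given robust constraint are assumed to be.  The feasible regions are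
    convex and solid, so points with rational coordinates are dense in them,
    and they are closed; hence whether the relaxed region contains a point
    preferred to the solution can be read off countably many rational points
    and thresholds ([exists_preferredP]). *)

(** * Convex sets, Radon and Helly *)

Section convexity.
Context (R : realType) (M : lmodType R).
Implicit Types (A : set M).

Lemma convex_setP A : convex_set A <->
  forall (t : R) x y, 0 <= t <= 1 -> A x -> A y -> A (t *: x + (1 - t) *: y).
Proof.
split=> [cA t x y /andP[t0 t1] Ax Ay | cA x y t].
  have := cA x y (Itv01 t0 t1); rewrite !inE => /(_ Ax Ay).
  exact.
rewrite !inE => Ax Ay; apply: (cA t%:num x y) => //.
by rewrite ge0 le1.
Qed.

Lemma convex_set_barycenter A (I : finType) (w : I -> R) (x : I -> M) :
  convex_set A -> (forall i, 0 <= w i) -> \sum_i w i = 1 ->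
  (forall i, 0 < w i -> A (x i)) -> A (\sum_i w i *: x i).
Proof.
move=> /convex_setP cA w0 w1 Ax.
(* The combination is built over a list, as the total weight times a point of
   the set; the point is arbitrary while the weight is still zero. *)
suff H s : exists a, (0 < \sum_(i <- s) w i -> A a) /\
    \sum_(i <- s) w i *: x i = (\sum_(i <- s) w i) *: a.
  have [a [+ ->]] := H (index_enum I).
  by rewrite w1 scale1r; apply.
elim: s => [|i s [a [Aa sE]]]; first by exists 0; rewrite !big_nil ltxx scaler0.
rewrite !big_cons sE; set W := \sum_(j <- s) w j.
have W0 : 0 <= W by exact: sumr_ge0.
have [W00|Wn0] := eqVneq W 0.
  exists (x i); split; last by rewrite W00 scale0r !addr0.
  by rewrite W00 addr0 => /Ax.
have Wpos : 0 < W by rewrite lt_def Wn0.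
have [wi0|win0] := eqVneq (w i) 0.
  by exists a; rewrite wi0 scale0r !add0r.
have wipos : 0 < w i by rewrite lt_def win0 w0.
have sn0 : w i + W != 0 by rewrite gt_eqF// addr_gt0.
exists ((w i / (w i + W)) *: x i + (1 - w i / (w i + W)) *: a); split.
  move=> _; apply: cA; [|exact: Ax|exact: Aa].
  rewrite divr_ge0 ?addr_ge0//= ler_pdivrMr ?addr_gt0// mul1r.
  by rewrite lerDl.
rewrite scalerDr !scalerA; congr (_ *: _ + _ *: _); field => //.
Qed.

End convexity.

(** The n vectors (1, x_i) lie in a space of dimension d + 1 < n. *)
Lemma affine_dependence (F : fieldType) (d n : nat) (x : 'I_n -> 'cV[F]_d) :
  (d.+1 < n)%N ->
  exists l : 'I_n -> F,
    [/\ exists i, l i != 0, \sum_i l i = 0 & \sum_i l i *: x i = 0].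
Proof.
move=> dn; pose X : 'M[F]_(n, d) := \matrix_(i, j) x i j 0.
pose A : 'M[F]_(n, 1 + d) := row_mx (const_mx 1) X.
have : kermx A != 0.
  rewrite kermx_eq0 /row_free neq_ltn.
  by rewrite (leq_ltn_trans (rank_leq_col A)).
move=> /rowV0Pn[v /sub_kermxP]; rewrite mul_mx_row -[0]row_mx0 => /eq_row_mx[v1 vX] v0.
exists (fun i => v 0 i); split.
- by have [i] := rV0Pn _ v0; exists i.
- move/matrixP : v1 => /(_ 0 0); rewrite !mxE => v1; rewrite -[RHS]v1.
  by apply: eq_bigr => i _; rewrite mxE mulr1.
- apply/colP => j; move/matrixP : vX => /(_ 0 j); rewrite !mxE summxE => vX.
  by rewrite -[RHS]vX; apply: eq_bigr => i _; rewrite !mxE.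
Qed.

(** Radon's theorem.  Separating the positive from the nonpositive coefficients
    of an affine dependence and normalizing writes one point as a convex
    combination of each of the two groups. *)
Lemma radon (R : realType) (d n : nat) (x : 'I_n -> 'cV[R]_d) :
  (d.+1 < n)%N ->
  exists (S : pred 'I_n) (z : 'cV[R]_d), forall A : set 'cV[R]_d, convex_set A ->
    ((forall i, S i -> A (x i)) \/ (forall i, ~~ S i -> A (x i))) -> A z.
Proof.
move=> /(affine_dependence x)[l [[k lk0] l0 lx0]].
pose s := \sum_(i | 0 < l i) l i.
have sN : s = \sum_(i | ~~ (0 < l i)) - l i.
  apply/eqP; rewrite sumrN -addr_eq0 -[X in _ == X]l0.
  by rewrite [X in _ == X](bigID (fun i => 0 < l i)).
have s0 : 0 < s.
  rewrite lt_def sumr_ge0 ?andbT; last by move=> i /ltW.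
  apply: contraNneq lk0 => s0; have [lk|lk] := boolP (0 < l k).
    have /eqP := s0; rewrite psumr_eq0; last by move=> i /ltW.
    by move=> /allP/(_ k (mem_index_enum _)); rewrite lk.
  have /eqP := s0; rewrite sN psumr_eq0; last by move=> i; rewrite oppr_ge0 leNgt.
  by move=> /allP/(_ k (mem_index_enum _)); rewrite lk oppr_eq0.
exists (fun i => 0 < l i), (\sum_(i | 0 < l i) (l i / s) *: x i) => A cA.
case=> Ax.
- rewrite big_mkcond/=.
  have -> : \sum_i (if 0 < l i then (l i / s) *: x i else 0) =
      \sum_i (if 0 < l i then l i / s else 0) *: x i.
    by apply: eq_bigr => i _; case: ifP => //; rewrite scale0r.
  apply: convex_set_barycenter => // [i||i].
  + by case: ifPn => // /ltW li0; rewrite divr_ge0// ltW.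
  + by rewrite -big_mkcond/= -mulr_suml divff// gt_eqF.
  + by case: ifPn => [li0 _|]; [exact: Ax|rewrite ltxx].
- have -> : \sum_(i | 0 < l i) (l i / s) *: x i =
      \sum_i (if ~~ (0 < l i) then - l i / s else 0) *: x i.
    have /eqP : s^-1 *: \sum_i l i *: x i = 0 by rewrite lx0 scaler0.
    rewrite scaler_sumr (bigID (fun i => 0 < l i))/= addr_eq0 => /eqP.
    under eq_bigr do rewrite scalerA mulrC.
    move=> ->; rewrite -sumrN big_mkcond/=; apply: eq_bigr => i _.
    by case: ifP => _; rewrite ?scale0r// scalerA -scaleNr mulNr mulrC.
  apply: convex_set_barycenter => // [i||i].
  + by case: ifPn => //; rewrite -leNgt => li0; rewrite divr_ge0 ?oppr_ge0// ltW.
  + by rewrite -big_mkcond/= -mulr_suml -sN divff// gt_eqF.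
  + by case: ifPn => [li0 _|]; [exact: Ax|rewrite ltxx].
Qed.

(** Helly's theorem, by induction on the number of sets: x_i lies in all the
    sets but the i-th, and a Radon point of the x_i lies in all of them. *)
Lemma helly (R : realType) (d n : nat) (C : 'I_n -> set 'cV[R]_d) :
  (forall i, convex_set (C i)) ->
  (forall J : {set 'I_n}, (#|J| <= d.+1)%N ->
     exists x, forall i, i \in J -> C i x) ->
  exists x, forall i, C i x.
Proof.
elim: n C => [|n IHn] C cC CJ.
  by have [|x _] := CJ finset.set0; [rewrite cards0|exists x => -[]].
have [nd|dn] := leqP n.+1 d.+1.
  have [|x Cx] := CJ [set: 'I_n.+1]%SET; first by rewrite cardsT card_ord.
  by exists x => i; apply: Cx; rewrite finset.in_setT.
have /choice[x Cx] : forall i, exists x, forall j, C (lift i j) x.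
  move=> i; apply: IHn => [j|J dJ]; first exact: cC.
  have [|x Cx] := CJ [set lift i j | j in J]%SET.
    by rewrite card_imset//; exact: lift_inj.
  by exists x => j jJ; apply: Cx; exact: imset_f.
have {}Cx i j : i != j -> C i (x j).
  by rewrite eq_sym => ji; have [k ->] := unlift_some ji.
have [S [z Sz]] := radon x dn.
exists z => i; apply: Sz => //.
have [Si|Si] := boolP (S i); [right|left] => j Sj; apply: Cx.
  by apply: contraNneq Sj => <-.
by apply: contraNneq Si => ->.
Qed.

(** * Cost with ties broken by the Euclidean norm *)

Section preference.
Context (R : realType) (d : nat).
Implicit Types (c x y : 'cV[R]_d) (C : set 'cV[R]_d) (t a b : R).

Definition sqnorm x : R := \sum_i x i 0 ^+ 2.

(** The strict lexicographic order on (cost, squared norm): the weak inequality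
    in the second case only overlaps with the first. *)
Definition preferred c y x :=
  objective c y < objective c x \/
  (objective c y <= objective c x /\ sqnorm y < sqnorm x).

Lemma objective_comb c t s x y :
  objective c (t *: x + s *: y) = t * objective c x + s * objective c y.
Proof.
by rewrite /objective mulmxDr -!scalemxAr !mxE.
Qed.

Lemma sqnorm_ge0 x : 0 <= sqnorm x.
Proof. by apply: sumr_ge0 => i _; exact: sqr_ge0. Qed.

Lemma sqnorm_gt0 x : x != 0 -> 0 < sqnorm x.
Proof.
move=> x0; rewrite lt_def sqnorm_ge0 andbT; apply: contra_neq x0 => /eqP.
rewrite psumr_eq0; last by move=> i _; exact: sqr_ge0.
move=> /allP x0; apply/colP => i; rewrite mxE; apply/eqP.
by have := x0 i (mem_index_enum _); rewrite sqrf_eq0.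
Qed.

Lemma sqnorm_conv t x y : sqnorm (t *: x + (1 - t) *: y) =
  t * sqnorm x + (1 - t) * sqnorm y - t * (1 - t) * sqnorm (x - y).
Proof.
rewrite /sqnorm !mulr_sumr -big_split -sumrB /=; apply: eq_bigr => i _.
by rewrite !mxE; ring.
Qed.

Lemma convex_preferred c x : convex_set [set y | preferred c y x].
Proof.
apply/convex_setP => t y1 y2 /andP[t0 t1] /= P1 P2.
have [->|tn0] := eqVneq t 0; first by rewrite scale0r add0r subr0 scale1r.
have [->|tn1] := eqVneq t 1; first by rewrite subrr scale0r addr0 scale1r.
have {}t0 : 0 < t by rewrite lt_def tn0.
have {}t1 : 0 < 1 - t by rewrite subr_gt0 lt_def eq_sym tn1.
have sq0 := sqnorm_ge0 (y1 - y2).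
rewrite /preferred objective_comb sqnorm_conv.
have tt0 : 0 <= t * (1 - t) * sqnorm (y1 - y2).
  by rewrite mulr_ge0// mulr_ge0// ltW.
set s := 1 - t in t1 tt0 *.
have ts : t + s = 1 by rewrite /s addrC subrK.
have sE (z : R) : z = t * z + s * z by rewrite -mulrDl ts mul1r.
case: P1 => [P1|[P1 Q1]]; case: P2 => [P2|[P2 Q2]].
- by left; rewrite [ltRHS]sE ltrD// ltr_pM2l.
- by left; rewrite [ltRHS]sE ltr_leD ?ltr_pM2l ?ler_pM2l.
- by left; rewrite [ltRHS]sE ler_ltD ?ltr_pM2l ?ler_pM2l.
right; split; first by rewrite [leRHS]sE lerD ?ler_pM2l.
rewrite ltrBlDr (@lt_le_trans _ _ (sqnorm x))//; last by rewrite lerDl.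
by rewrite [ltRHS]sE ltrD// ltr_pM2l.
Qed.

(** Two such points have the same cost and the same norm, and if they were
    distinct their midpoint would be strictly shorter. *)
Lemma preferred_min_unique c C x y : convex_set C -> C x -> C y ->
  (forall z, C z -> ~ preferred c z x) -> (forall z, C z -> ~ preferred c z y) ->
  x = y.
Proof.
move=> /convex_setP cC Cx Cy xmin ymin; apply/eqP/negP => /negP xy.
have oxy : objective c x = objective c y.
  apply/eqP; rewrite eq_le; apply/andP; split; rewrite leNgt; apply/negP => o.
    by apply: (xmin y) => //; left.
  by apply: (ymin x) => //; left.
have sxy : sqnorm x = sqnorm y.
  apply/eqP; rewrite eq_le; apply/andP; split; rewrite leNgt; apply/negP => o.
    by apply: (xmin y) => //; right; rewrite oxy.
  by apply: (ymin x) => //; right; rewrite oxy.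
have half : 0 <= (2^-1 : R) <= 1 by lra.
apply: (xmin _ (cC _ _ _ half Cx Cy)); right.
rewrite objective_comb sqnorm_conv -oxy -sxy; split; first by lra.
have : 0 < sqnorm (x - y) by apply: sqnorm_gt0; rewrite subr_eq0.
by move=> ?; nra.
Qed.

(** * Rational points of solid convex sets *)

Lemma continuous_sum_coord (h : 'I_d -> R -> R) : (forall i, continuous (h i)) ->
  continuous (fun x : 'cV[R]_d => \sum_i h i (x i 0)).
Proof.
move=> hc; elim: (index_enum _) => [|i s IHs].
  rewrite (_ : (fun=> _) = cst 0); first exact: cst_continuous.
  by apply/funext => x; rewrite big_nil.
rewrite (_ : (fun=> _) = (fun x => h i (x i 0) + \sum_(j <- s) h j (x j 0))).
  move=> x.
  have hix := cvg_comp _ _ (@coord_continuous R d 1 i 0 x) (hc i (x i 0)).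
  exact: (@cvgD _ _ _ (nbhs (x : 'cV[R]_d)) (nbhs_filter (x : 'cV[R]_d)) _ _ _ _ hix (IHs x)).
by apply/funext => x; rewrite big_cons.
Qed.

Lemma continuous_objective c : continuous (objective c).
Proof.
have -> : objective c = fun x => \sum_i c i 0 * x i 0.
  by apply/funext => x; rewrite /objective mxE; apply: eq_bigr => i _; rewrite mxE.
apply: (continuous_sum_coord (h := fun i u => c i 0 * u)) => i u.
exact: mulrl_continuous.
Qed.

Lemma continuous_sqnorm : continuous sqnorm.
Proof.
apply: (continuous_sum_coord (h := fun i u => u ^+ 2)) => i u.
exact: exprn_continuous.
Qed.

Lemma nbhs_objective_lt c x a : objective c x < a ->
  nbhs x [set y | objective c y < a].
Proof.
move=> xa; apply: (@continuous_objective c x [set u | u < a]).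
by apply: open_nbhs_nbhs; split => //; exact: open_lt.
Qed.

Lemma nbhs_sqnorm_lt x b : sqnorm x < b -> nbhs x [set y | sqnorm y < b].
Proof.
move=> xb; apply: (@continuous_sqnorm x [set u | u < b]).
by apply: open_nbhs_nbhs; split => //; exact: open_lt.
Qed.

Definition ratv (q : 'cV[rat]_d) : 'cV[R]_d := map_mx ratr q.

Lemma ratv_dense (x : 'cV[R]_d) e : 0 < e -> exists q, `|x - ratv q| < e.
Proof.
move=> e0.
have /choice[q Hq] : forall i, exists u : rat, x i 0 - e < ratr u < x i 0 + e.
  move=> i; have [|u] := @rat_in_itvoo R (x i 0 - e) (x i 0 + e); first by lra.
  by rewrite in_itv/= => ?; exists u.
exists (\col_i q i).
suff : ball x e (ratv (\col_i q i)) by rewrite -ball_normE.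
split => // i j; rewrite ord1 !mxE -ball_normE /=.
by rewrite ltr_distl; have := Hq i; lra.
Qed.

(** A solid convex set is star-shaped with room to spare: around the point that
    divides the segment from x to the centre p of a ball there is a ball too,
    shrunk in proportion. *)
Lemma solid_star C p e x t y : convex_set C -> ball p e `<=` C -> C x ->
  0 < t <= 1 -> `|t *: p + (1 - t) *: x - y| < t * e -> C y.
Proof.
move=> /convex_setP cC pC Cx /andP[t0 t1] ye.
have -> : y = t *: (p - t^-1 *: (t *: p + (1 - t) *: x - y)) + (1 - t) *: x.
  by apply/colP => i; rewrite !mxE; field; rewrite gt_eqF.
apply: cC => //; first by rewrite (ltW t0).
apply: pC; rewrite -ball_normE /= opprB addrC subrK normrZ.
by rewrite gtr0_norm ?invr_gt0// mulrC ltr_pdivrMr// mulrC.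
Qed.

(** Moving x slightly towards an interior point reaches the interior, where
    rational points are available. *)
Lemma solid_ratv C x U : convex_set C -> C° !=set0 -> C x -> nbhs x U ->
  exists q, C (ratv q) /\ U (ratv q).
Proof.
move=> cC [p /nbhs_ballP[e /= e0 pC]] Cx /nbhs_ballP[r /= r0 xU].
pose t := Num.min 1 (r / (2 * (`|p - x| + 1))).
have px0 : 0 < `|p - x| + 1 by rewrite ltr_wpDl.
have t0 : 0 < t by rewrite lt_min ltr01 divr_gt0// mulr_gt0.
have t1 : t <= 1 by rewrite ge_min lexx.
have tr : t * `|p - x| < r / 2.
  rewrite (@lt_le_trans _ _ (t * (`|p - x| + 1)))//.
    by rewrite ltr_pM2l// ltrDl.
  rewrite -ler_pdivlMr// (@le_trans _ _ (r / (2 * (`|p - x| + 1))))//.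
    by rewrite ge_min lexx orbT.
  by rewrite invfM mulrA.
have m0 : 0 < Num.min (t * e) (r / 2) by rewrite lt_min mulr_gt0// divr_gt0.
have [q] := ratv_dense (t *: p + (1 - t) *: x) m0.
rewrite lt_min => /andP[qe qr]; exists q; split.
  by apply: (solid_star cC pC Cx _ qe); rewrite t0.
apply: xU; rewrite -ball_normE /=.
have -> : x - ratv q = (t *: p + (1 - t) *: x - ratv q) - t *: (p - x).
  apply/colP => i; rewrite !mxE; ring.
rewrite (le_lt_trans (ler_normB _ _))// [r]splitr ltrD//.
by rewrite normrZ gtr0_norm.
Qed.

End preference.

(** * Closedness and compactness *)

Section sublevel_sets.
Context (R : realType) (d : nat).
Implicit Types (h : 'cV[R]_d -> R) (H : set ('cV[R]_d -> R)).

Lemma convex_functionP h : convex_function setT h ->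
  forall t x y, 0 <= t <= 1 ->
    h (t *: x + (1 - t) *: y) <= t * h x + (1 - t) * h y.
Proof.
move=> ch t x y /andP[t0 t1].
by have := ch (Itv01 t0 t1) x y; rewrite !inE => /(_ I I).
Qed.

(** Arbitrary families are allowed because a robust constraint is one ordinary
    constraint for each point of a ball. *)
Definition sublevel H : set 'cV[R]_d := [set x | forall h, H h -> h x <= 0].

Lemma convex_sublevel H : (forall h, H h -> convex_function setT h) ->
  convex_set (sublevel H).
Proof.
move=> cH; apply/convex_setP => t x y /[dup] t01 /andP[t0 t1] Hx Hy h Hh.
rewrite (le_trans (convex_functionP (cH h Hh) _ _ t01))//.
have := Hx h Hh; have := Hy h Hh => hx hy.
by rewrite -[leRHS]addr0 lerD// mulr_ge0_le0// subr_ge0.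
Qed.

(** If p is interior and z is a limit point, the half-open segment from p to z
    lies in the set.  Every constraint h is then nonpositive on that segment,
    and convexity on the line through p and z carries this over to z.  Only
    one-dimensional continuity of convex functions is involved. *)
Lemma closed_sublevel H : (forall h, H h -> convex_function setT h) ->
  (sublevel H)° !=set0 -> closed (sublevel H).
Proof.
move=> cH [p /nbhs_ballP[e /= e0 pH]] z zH h Hh.
rewrite leNgt; apply/negP => hz.
have seg t : 0 < t <= 1 -> h (t *: p + (1 - t) *: z) <= 0.
  move=> /[dup] t01 /andP[t0 t1].
  have te : 0 < t * e by rewrite mulr_gt0.
  have [y [Hy]] := zH _ (nbhsx_ballx z _ te).
  rewrite -ball_normE /= => zy.
  apply: (solid_star (convex_sublevel cH) pH Hy t01 _) => //.
  have -> : t *: p + (1 - t) *: y - (t *: p + (1 - t) *: z) = (1 - t) *: (y - z).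
    by apply/colP => i; rewrite !mxE; ring.
  rewrite normrZ ger0_norm ?subr_ge0// distrC (le_lt_trans _ zy)//.
  by rewrite ler_piMl// gerBl ltW.
(* q is p reflected through z, so that z lies between the segment and q. *)
pose q := 2 *: z - p.
have hq t : 0 < t <= 1 -> h z <= t * `|h q|.
  move=> /[dup] t01 /andP[t0 t1]; have := seg _ t01; set w := t *: p + _ => hw.
  have t10 : 0 < 1 + t by rewrite ltr_wpDl.
  have -> : z = (1 + t)^-1 *: w + (1 - (1 + t)^-1) *: q.
    by apply/colP => i; rewrite !mxE; field; rewrite gt_eqF.
  have l01 : 0 <= (1 + t)^-1 <= 1.
    by rewrite invr_ge0 ltW//= invf_le1// lerDl ltW.
  rewrite (le_trans (convex_functionP (cH h Hh) _ _ l01))//.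
  have -> : 1 - (1 + t)^-1 = t / (1 + t) by field; rewrite gt_eqF.
  rewrite -[leRHS]add0r lerD//.
    by rewrite mulr_ge0_le0// invr_ge0 ltW.
  rewrite (@le_trans _ _ (t / (1 + t) * `|h q|))//.
    by rewrite ler_wpM2l ?ler_norm// divr_ge0// ltW.
  by rewrite ler_wpM2r// ler_pdivrMr// ler_pMr// lerDl ltW.
have q0 : 0 < `|h q| + h z by rewrite ltr_wpDl.
(* With this parameter, t * `|h q| is strictly less than h z. *)
have := hq (h z / (`|h q| + h z)).
rewrite divr_gt0//= ler_pdivrMr// mul1r lerDr normr_ge0 => /(_ isT).
rewrite -mulrA -ler_pdivrMl// mulVf ?gt_eqF// mulrC ler_pdivlMr// mul1r.
by rewrite leNgt ltrDl hz.
Qed.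

End sublevel_sets.

Section compactness.
Context (R : realType) (d : nat).
Implicit Types (c x : 'cV[R]_d) (C : set 'cV[R]_d).

Lemma compact_box (M : R) :
  compact [set x : 'cV[R]_d | forall i, `|x i 0| <= M].
Proof.
pose B := [set v : 'rV[R]_d | forall i, `[- M, M]%classic (v ord0 i)].
have cB : compact B.
  apply: (@rV_compact _ _ (fun=> `[- M, M]%classic)) => _.
  exact: segment_compact.
have -> : [set x : 'cV[R]_d | forall i, `|x i 0| <= M] = trmx @` B.
  apply/seteqP; split => [x xM|_ [v vB <-] i /=].
    exists x^T; last by rewrite trmxK.
    by move=> i; rewrite /= mxE in_itv/= -ler_norml; exact: xM.
  by rewrite mxE ler_norml; have := vB i; rewrite /= in_itv.
apply: continuous_compact => //; apply: continuous_subspaceT => v A.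
move=> /nbhs_ballP[e /= e0 eA]; apply/nbhs_ballP; exists e => // w [_ vw].
by apply: eA; split => // i j; rewrite !mxE.
Qed.

(** Bounded norms give a cluster point, at which both inequalities survive in
    their weak form. *)
Lemma objective_sqnorm_limit c C (a b : R) : closed C ->
  (forall a', a < a' -> exists y, [/\ C y, objective c y < a' & sqnorm y < b]) ->
  exists z, [/\ C z, objective c z <= a & sqnorm z <= b].
Proof.
move=> clC Ca.
have /choice[y yP] : forall n : nat,
    exists y, [/\ C y, objective c y < a + n.+1%:R^-1 & sqnorm y < b].
  by move=> n; apply: Ca; rewrite ltrDl.
pose K := [set x : 'cV[R]_d | forall i, `|x i 0| <= b + 1].
have Ky : (y @ \oo) K.
  exists 0 => // n _ i; have [_ _ /ltW yb] := yP n.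
  have : y n i 0 ^+ 2 <= b.
    rewrite (le_trans _ yb)// /sqnorm (bigD1 i)//= lerDl.
    by apply: sumr_ge0 => j _; exact: sqr_ge0.
  rewrite -real_normK ?num_real// => yb2.
  have := normr_ge0 (y n i 0); set u := `|_| in yb2 *; nra.
have [z [_ yz]] := compact_box (fmap_proper_filter y _) Ky.
exists z; split.
- apply: clC => U zU; apply: yz => //.
  by exists 0 => // n _; have [] := yP n.
- rewrite leNgt; apply/negP => az.
  pose m := (a + objective c z) / 2.
  have az2 : 0 < m - a by rewrite /m; lra.
  have ym : \forall n \near \oo, objective c (y n) < m.
    near=> n; have [_ yn _] := yP n; rewrite /= (lt_trans yn)// -ltrBrDl.
    near: n; exact: (near_infty_natSinv_lt (PosNum az2)).
  have [] := yz [set x | objective c x < m] [set x | m < objective c x] ym.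
  + apply: (@continuous_objective _ _ c z [set u | m < u]).
    by apply: open_nbhs_nbhs; split; [exact: open_gt|rewrite /= /m; lra].
  + by move=> x [/= xm]; rewrite ltNge (ltW xm).
- rewrite leNgt; apply/negP => bz.
  have [] := yz [set x | sqnorm x < b] [set x | b < sqnorm x].
  + by exists 0 => // n _; have [] := yP n.
  + apply: (@continuous_sqnorm _ _ z [set u | b < u]).
    by apply: open_nbhs_nbhs; split; [exact: open_gt|].
  + by move=> x [/= xm]; rewrite ltNge (ltW xm).
Unshelve. all: by end_near. Qed.

End compactness.

(** * Detecting a preferred point with rational data *)

Section rational_tests.
Context (R : realType) (d : nat).
Implicit Types (c x : 'cV[R]_d) (C : set 'cV[R]_d).

Definition cheap c C (a : rat) := exists q,
  C (ratv R q) /\ objective c (ratv R q) < ratr a.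

Definition cheap_short c C (a b : rat) := exists q,
  [/\ C (ratv R q), objective c (ratv R q) < ratr a & sqnorm (ratv R q) < ratr b].

(** Thresholds a with [cheap c C a] are those above the infimum of the cost over
    C, so that the optimal value need not be rational.  The gap between b and
    b' keeps the comparison of norms strict in the limit. *)
Definition improvement_test c C C' :=
  (exists a, cheap c C' a /\ ~ cheap c C a) \/
  (exists b b', [/\ b < b', forall a, cheap c C a -> cheap_short c C' a b &
     exists a, cheap c C a /\ ~ cheap_short c C a b']).

Lemma rat_between (u v : R) : u < v -> exists a : rat, u < ratr a < v.
Proof. by move=> /rat_in_itvoo[a]; rewrite in_itv/=; exists a. Qed.

Lemma cheapP c C x (a : rat) : convex_set C -> C° !=set0 ->
  is_solution c C x -> cheap c C a <-> objective c x < ratr a.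
Proof.
move=> cC iC [Cx xmin]; split=> [[q [Cq]]|xa].
  by apply: le_lt_trans; exact: xmin.
by have [q [Cq qa]] := solid_ratv cC iC Cx (nbhs_objective_lt xa); exists q.
Qed.

Lemma cheap_short_of c C x (a b : rat) : convex_set C -> C° !=set0 -> C x ->
  objective c x < ratr a -> sqnorm x < ratr b -> cheap_short c C a b.
Proof.
move=> cC iC Cx xa xb.
have [q [Cq [qa qb]]] := solid_ratv cC iC Cx
  (filterI (nbhs_objective_lt xa) (nbhs_sqnorm_lt xb)).
by exists q.
Qed.

Lemma cheap_short_limit c C x (b : rat) : closed C ->
  (forall a : rat, objective c x < ratr a -> cheap_short c C a b) ->
  exists z, [/\ C z, objective c z <= objective c x & sqnorm z <= ratr b].
Proof.
move=> clC xC; apply: objective_sqnorm_limit => // a' /rat_between[a /andP[xa aa']].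
have [q [Cq qa qb]] := xC a xa; exists (ratv R q); split => //.
exact: lt_trans aa'.
Qed.

(** Both directions pass to the limit along costs decreasing to that of x.  In
    C, points with norms below that of x would accumulate at a second optimal
    solution, which uniqueness excludes; in C', they accumulate at a point
    preferred to x. *)
Lemma exists_preferredP c C C' x :
  convex_set C -> closed C -> C° !=set0 ->
  convex_set C' -> closed C' -> C `<=` C' ->
  is_solution c C x -> (forall y, is_solution c C y -> y = x) ->
  (exists y, C' y /\ preferred c y x) <-> improvement_test c C C'.
Proof.
move=> cC clC iC cC' clC' CC' solx uniqx.
have iC' : C'° !=set0 by apply: subset_nonempty iC; exact: interiorS.
have cheapE a := cheapP a cC iC solx.
split=> [[y [C'y yx]]|].
  have [yltx|xley] := ltP (objective c y) (objective c x).
    have [a /andP[ya ax]] := rat_between yltx.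
    left; exists a; split; last by rewrite cheapE => /(lt_trans ax); rewrite ltxx.
    have [q [Cq qa]] := solid_ratv cC' iC' C'y (nbhs_objective_lt ya).
    by exists q.
  case: yx => [|[yx sq]]; first by rewrite ltNge xley.
  have [b /andP[yb bx]] := rat_between sq.
  have [b' /andP[bb' b'x]] := rat_between bx.
  right; exists b, b'; split; first by rewrite -(ltr_rat R).
    move=> a /cheapE xa; apply: (cheap_short_of cC' iC' C'y _ yb).
    exact: le_lt_trans xa.
  apply: contrapT => nex.
  have [|z [Cz zx zb]] := @cheap_short_limit c C x b' clC.
    by move=> a /cheapE Ca; apply: contrapT => nCa; apply: nex; exists a.
  have zE : z = x.
    by apply: uniqx; split => // w Cw; apply: le_trans zx _; exact: solx.2.
  by move: (le_lt_trans zb b'x); rewrite zE ltxx.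
case=> [[a [[q [C'q qa]] nCa]]|[b [b' [bb' short [a [Ca nCa]]]]]].
  exists (ratv R q); split => //; left; apply: lt_le_trans qa _.
  by rewrite leNgt; apply/negP => /cheapE.
have [|z [C'z zx zb]] := @cheap_short_limit c C' x b clC'.
  by move=> a' /cheapE; exact: short.
exists z; split => //; right; split => //; apply: le_lt_trans zb _.
apply: (@lt_le_trans _ _ (ratr b')); first by rewrite ltr_rat.
rewrite leNgt; apply/negP => xb'; apply: nCa.
by apply: (cheap_short_of cC iC solx.1 _ xb'); exact/cheapE.
Qed.

End rational_tests.


(** Apply Helly's theorem to the sets G `&` C i and to the set of points of G
    preferred to x.  They have no common point, hence neither do some d + 1 of
    them.  As x lies in every G `&` C i, the last set is among these, so that
    at most d of the sets C i remain. *)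
Lemma helly_support (R : realType) (d N : nat) (c : 'cV[R]_d)
    (G : set 'cV[R]_d) (C : 'I_N -> set 'cV[R]_d) (x : 'cV[R]_d) :
  (d <= N)%N -> convex_set G -> (forall i, convex_set (C i)) ->
  G x -> (forall i, C i x) ->
  (forall y, G y -> (forall i, C i y) -> ~ preferred c y x) ->
  exists J : {set 'I_N}, #|J| = d /\
    forall y, G y -> (forall i, i \in J -> C i y) -> ~ preferred c y x.
Proof.
move=> dN cG cC Gx Cx xmin; apply: contrapT => nJ.
(* Index 0 stands for the set of preferred points. *)
pose K (i : 'I_N.+1) : set 'cV[R]_d :=
  G `&` (if unlift ord0 i is Some j then C j else [set y | preferred c y x]).
have cI (A B : set 'cV[R]_d) : convex_set A -> convex_set B -> convex_set (A `&` B).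
  move=> /convex_setP cA /convex_setP cB; apply/convex_setP => t y z t01 [Ay By] [Az Bz].
  by split; [exact: cA|exact: cB].
have cK i : convex_set (K i).
  apply: cI => //; case: (unlift ord0 i) => [j|]; first exact: cC.
  exact: convex_preferred.
have KJ (J : {set 'I_N.+1}) : (#|J| <= d.+1)%N -> exists y, forall i, i \in J -> K i y.
  move=> dJ; have [J0|J0] := boolP (ord0 \in J); last first.
    exists x => i iJ; split => //; case: unliftP => [j _|i0]; first exact: Cx.
    by rewrite -i0 iJ in J0.
  pose J1 : {set 'I_N} := [set j | lift ord0 j \in J]%SET.
  have J1d : (#|J1| <= d)%N.
    rewrite -ltnS (leq_trans _ dJ)// (cardsD1 ord0 J) J0 add1n ltnS.
    rewrite -(card_imset _ (@lift_inj _ ord0)); apply/subset_leq_card/fintype.subsetP.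
    by move=> _ /imsetP[j jJ ->]; rewrite !inE in jJ *; rewrite jJ andbT.
  (* Fewer than d constraints may remain; the set is completed to exactly d. *)
  have [J2 J12 J2d] : exists2 J2 : {set 'I_N}, J1 \subset J2 & #|J2| = d.
    have : (d - #|J1| <= #|~: J1|)%N.
      by rewrite leq_subLR cardsC card_ord.
    move=> /card_geqP[s [us ss sJ1]].
    exists (J1 :|: [set j in s])%SET; first exact: finset.subsetUl.
    have -> : #|(J1 :|: [set j in s])%SET| = (#|J1| + size s)%N.
      have J1s : (J1 :&: [set j in s] = finset.set0)%SET.
        apply/finset.setP => j; rewrite !inE; apply/negP => /andP[jJ /sJ1].
        by rewrite !inE jJ.
      rewrite cardsU J1s cards0 subn0 -(card_uniqP us); congr addn.
      by apply: eq_card => j; rewrite inE.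
    by rewrite ss subnKC.
  apply: contrapT => nK; apply: nJ; exists J2; split => // y Gy Cy yx.
  apply: nK; exists y => i iJ; split => //; case: unliftP => [j ij|//].
  by apply: Cy; apply: (fintype.subsetP J12); rewrite inE -ij.
have [y Ky] := helly cK KJ.
apply: (xmin y) => [|i|].
- by have [] := Ky ord0.
- by have [_] := Ky (lift ord0 i); rewrite liftK.
- by have [_] := Ky ord0; rewrite unlift_none.
Qed.

(** * Measurability and the union bound *)

Section countable_quantifiers.
Context disp (T : measurableType disp).

Lemma measurable_exists (K : countType) (A : K -> set T) :
  (forall k, measurable (A k)) -> measurable [set x | exists k, A k x].
Proof.
move=> mA.
have -> : [set x | exists k, A k x] =
    \bigcup_n (if unpickle n is Some k then A k else set0).
  apply/seteqP; split => [x [k Akx]|x [n _]].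
    by exists (pickle k) => //; rewrite pickleK.
  by case: unpickle => // k Akx; exists k.
by apply: bigcupT_measurable => n; case: unpickle.
Qed.

Lemma measurable_forall (K : countType) (A : K -> set T) :
  (forall k, measurable (A k)) -> measurable [set x | forall k, A k x].
Proof.
move=> mA.
have -> : [set x | forall k, A k x] = ~` [set x | exists k, (~` A k) x].
  apply/seteqP; split => [x Ax [k]|x nAx k]; first by apply; exact: Ax.
  by apply: contrapT => nAk; apply: nAx; exists k.
by apply: measurableC; apply: measurable_exists => k; exact: measurableC.
Qed.

Lemma measurable_imply (A B : set T) :
  measurable A -> measurable B -> measurable [set x | A x -> B x].
Proof.
move=> mA mB; have -> : [set x | A x -> B x] = ~` A `|` B.
  apply/seteqP; split => x /=; last by case.
  by move=> AB; have [Ax|] := pselect (A x); [right; exact: AB|left].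
by apply: measurableU => //; exact: measurableC.
Qed.

Lemma measurable_prop (p : Prop) : measurable [set _ : T | p].
Proof.
have [h|h] := pselect p.
  by rewrite (_ : [set _ | p] = setT)//; apply/seteqP; split.
by rewrite (_ : [set _ | p] = set0)//; apply/seteqP; split.
Qed.

Lemma measurable_improvement_test (R : realType) (d : nat) (c : 'cV[R]_d)
    (C C' : T -> set 'cV[R]_d) :
  (forall x, measurable [set t | C t x]) ->
  (forall x, measurable [set t | C' t x]) ->
  measurable [set t | improvement_test c (C t) (C' t)].
Proof.
move=> mC mC'.
have mcheap (D : T -> set 'cV[R]_d) (mD : forall x, measurable [set t | D t x]) a :
    measurable [set t | cheap c (D t) a].
  apply: measurable_exists => q.
  apply: (measurableI [set t | D t (ratv R q)]
    [set _ | objective c (ratv R q) < ratr a]) => //.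
  exact: measurable_prop.
have mshort (D : T -> set 'cV[R]_d) (mD : forall x, measurable [set t | D t x]) a b :
    measurable [set t | cheap_short c (D t) a b].
  apply: measurable_exists => q.
  rewrite (_ : (fun _ => _) = [set t | D t (ratv R q)] `&`
    [set _ | objective c (ratv R q) < ratr a /\ sqnorm (ratv R q) < ratr b]).
    by apply: measurableI => //; exact: measurable_prop.
  by apply/seteqP; split => t /=; [move=> [? ? ?]|move=> [? [? ?]]].
apply: measurableU.
  apply: measurable_exists => a.
  apply: (measurableD (A := [set t | cheap c (C' t) a])); exact: mcheap.
apply: measurable_exists => b; apply: measurable_exists => b'.
rewrite (_ : (fun _ => _) = [set _ | b < b'] `&`
  ([set t | forall a, cheap c (C t) a -> cheap_short c (C' t) a b] `&`
   [set t | exists a, cheap c (C t) a /\ ~ cheap_short c (C t) a b'])).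
  apply: measurableI; first exact: measurable_prop.
  apply: measurableI.
    apply: measurable_forall => a; apply: measurable_imply; first exact: mcheap.
    exact: mshort.
  apply: measurable_exists => a.
  apply: (measurableD (A := [set t | cheap c (C t) a])); first exact: mcheap.
  exact: mshort.
by apply/seteqP; split => t /=; [move=> [? ? ?]|move=> [? [? ?]]].
Qed.

End countable_quantifiers.

Lemma measure_finite_union disp (T : measurableType disp) (R : realType)
    (mu : {measure set T -> \bar R}) (K : finType) (Q : pred K) (B : K -> set T)
    (A : set T) :
  measurable A -> (forall k, measurable (B k)) ->
  (forall x, A x -> exists2 k, Q k & B k x) ->
  (mu A <= \sum_(k | Q k) mu (B k))%E.
Proof.
move=> mA mB AB.
have mU (s : seq K) : measurable (\big[setU/set0]_(k <- s | Q k) B k).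
  by apply: bigsetU_measurable.
apply: (@le_trans _ _ (mu (\big[setU/set0]_(k | Q k) B k))).
  apply: le_measure; rewrite ?inE// => x /AB[k Qk Bx].
  by rewrite (bigD1 k)//=; left.
elim: (index_enum K) => [|k s IHs]; first by rewrite !big_nil measure0.
rewrite !big_cons; case: ifPn => // Qk.
by rewrite (le_trans (measureU2 _ _ _))// leeD2l.
Qed.


(** * Products of probabilities with some coordinates frozen *)

Section product_sections.
Context d (T : measurableType d) (R : realType).
Local Open Scope ereal_scope.

Lemma prod_cons_integral n (P : probability T R)
    (Q : probability (n.-tuple T) R) (B : set (n.+1.-tuple T)) :
  measurable B ->
  prod_cons P Q B = \int[P]_t Q [set s | B (tcons (t, s))] /\
  prod_cons P Q B = \int[Q]_s P [set t | B (tcons (t, s))].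
Proof.
move=> mB; have mC : measurable (@tcons d T n @^-1` B).
  by rewrite -[X in measurable X]setTI; exact: measurable_tcons.
have xE t : xsection (@tcons d T n @^-1` B) t = [set s | B (tcons (t, s))].
  by apply/seteqP; split => s; rewrite /xsection /= inE.
have yE s : ysection (@tcons d T n @^-1` B) s = [set t | B (tcons (t, s))].
  by apply/seteqP; split => t; rewrite /ysection /= inE.
rewrite /prod_cons /pushforward; split.
  by apply: eq_integral => t _; rewrite /= xE.
rewrite (product_measure_unique (m' := (P \x^ Q)))//.
  by apply: eq_integral => s _; rewrite /= yE.
by move=> A1 A2 mA1 mA2; exact: product_measure2E.
Qed.

Lemma measurable_tcons_section1 n (B : set (n.+1.-tuple T)) t :
  measurable B -> measurable [set s | B (tcons (t, s))].
Proof.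
move=> mB; rewrite -[X in measurable X]setTI.
apply: (measurableT_comp (@measurable_tcons _ T n) _ measurableT mB).
exact: measurable_pair1.
Qed.

Lemma measurable_tcons_section2 n (B : set (n.+1.-tuple T)) s :
  measurable B -> measurable [set t | B (tcons (t, s))].
Proof.
move=> mB; rewrite -[X in measurable X]setTI.
apply: (measurableT_comp (@measurable_tcons _ T n) _ measurableT mB).
exact: measurable_pair2.
Qed.

Lemma measurable_fun_tcons_section2 n (P : probability T R)
    (B : set (n.+1.-tuple T)) :
  measurable B -> measurable_fun setT (fun s => P [set t | B (tcons (t, s))]).
Proof.
move=> mB; have mC : measurable (@tcons d T n @^-1` B).
  by rewrite -[X in measurable X]setTI; exact: measurable_tcons.
apply: eq_measurable_fun (measurable_fun_ysection P mC) => s _ /=.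
by congr (P _); apply/seteqP; split => t; rewrite /ysection /= inE.
Qed.

Lemma measurable_fun_tcons_section1 n (Q : probability (n.-tuple T) R)
    (B : set (n.+1.-tuple T)) :
  measurable B -> measurable_fun setT (fun t => Q [set s | B (tcons (t, s))]).
Proof.
move=> mB; have mC : measurable (@tcons d T n @^-1` B).
  by rewrite -[X in measurable X]setTI; exact: measurable_tcons.
apply: eq_measurable_fun (measurable_fun_xsection Q mC) => t _ /=.
by congr (Q _); apply/seteqP; split => s; rewrite /xsection /= inE.
Qed.

(** The sets A may depend on the coordinates in I in a non-measurable way; only
    B has to be measurable.  Induction on n: a first coordinate in I is
    integrated last and costs a factor at most 1, the bound being uniform in
    it.  A first coordinate outside I is integrated first: its section has
    probability at most [b ord0] and is null outside the set B' of tails with a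
    section of positive probability, to which the induction hypothesis
    applies. *)
Lemma prod_probability_le n (P : 'I_n -> probability T R) (I : pred 'I_n)
    (b : 'I_n -> R) (B : set (n.-tuple T)) :
  measurable B -> (forall i, (0 <= b i)%R) ->
  (forall eta j, B eta -> ~~ I j -> exists A : set T,
    [/\ measurable A, P j A <= (b j)%:E &
       forall eta', B eta' -> (forall i, I i -> tnth eta' i = tnth eta i) ->
         A (tnth eta' j)]) ->
  prod_probability P B <= (\prod_(i | ~~ I i) b i)%:E.
Proof.
elim: n P I b B => [|n IHn] P I b B mB b0 BA.
  by rewrite big_ord0; exact: probability_le1.
rewrite big_mkcond big_ord_recl -big_mkcond/=.
have prod0 : (0 <= \prod_(i | ~~ I (lift ord0 i)) b (lift ord0 i))%R.
  exact: prodr_ge0.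
have tE t t' (s s' : n.-tuple T) : (I ord0 -> t' = t) ->
    (forall i, I (lift ord0 i) -> tnth s' i = tnth s i) ->
    forall i, I i -> tnth (tcons (t', s')) i = tnth (tcons (t, s)) i.
  move=> tt' ss' i; case: (unliftP ord0 i) => [k ->|->].
    by rewrite !tnthS => /ss'.
  by rewrite !tnth0 => /tt'.
have [I0|I0] := boolP (I ord0); rewrite /=.
  rewrite mul1r (prod_cons_integral _ _ mB).1.
  rewrite -[leRHS]mule1 -(probability_setT (P ord0)) -integral_cst//.
  apply: ge0_le_integral => //=.
  - exact: measurable_fun_tcons_section1.
  - move=> t _; apply: IHn => //; first exact: measurable_tcons_section1.
    move=> s j Bs Ij; have [A [mA PA AB]] := BA _ (lift ord0 j) Bs Ij.
    exists A; split => // s' Bs' ss'.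
    by have := AB _ Bs' (tE _ _ _ _ (fun=> erefl) ss'); rewrite tnthS.
rewrite (prod_cons_integral _ _ mB).2 EFinM.
set Q := prod_probability _; pose p s := P ord0 [set t | B (tcons (t, s))].
have mp : measurable_fun setT p by exact: measurable_fun_tcons_section2.
pose B' := [set s | 0 < p s].
have mB' : measurable B'.
  by rewrite -[X in measurable X]setTI; exact: emeasurable_fun_o_infty.
apply: (@le_trans _ _ (\int[Q]_s ((b ord0)%:E * (\1_B' s)%:E))).
  apply: ge0_le_integral => //=.
  - by apply: measurable_funeM; apply/measurable_EFinP; exact: measurable_indic.
  - move=> s _; rewrite indicE.
    have [sB'|] := boolP (s \in B'); last first.
      by rewrite notin_setE/= => /negP; rewrite -leNgt mule0.
    rewrite mule1.
    have : p s != 0 by move: sB'; rewrite inE /B' /= lt0e => /andP[].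
    rewrite /p; have [->|/set0P[t0 Bt0] _] := eqVneq [set t | B (tcons (t, s))] set0.
      by rewrite measure0 eqxx.
    have [A [mA PA AB]] := BA _ ord0 Bt0 I0; apply: le_trans PA.
    apply: le_measure; rewrite ?inE//; first exact: measurable_tcons_section2.
    move=> t /= Bt; have := AB _ Bt; rewrite tnth0; apply.
    by apply: tE => //; rewrite (negbTE I0).
rewrite ge0_integralZl//; [|by apply/measurable_EFinP; exact: measurable_indic|].
  rewrite integral_indic// setIT; apply: lee_wpmul2l; first by rewrite lee_fin.
  apply: IHn => // s j; rewrite /B' /p /= => ps Ij.
  have [E0|/set0P[t0 Bt0]] := eqVneq [set t | B (tcons (t, s))] set0.
    by move: ps; rewrite E0 measure0 ltxx.
  have [A [mA PA AB]] := BA _ (lift ord0 j) Bt0 Ij.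
  exists A; split => // s' ps' ss'.
  have [E0|/set0P[t' Bt']] := eqVneq [set t | B (tcons (t, s'))] set0.
    by move: ps'; rewrite E0 measure0 ltxx.
  have := AB _ Bt'; rewrite tnthS; apply.
  by apply: tE => //; rewrite (negbTE I0).
by rewrite lee_fin.
Qed.
End product_sections.

(** * Transport and violation probabilities *)

Lemma continuous_measurable_borel (T U : ptopologicalType) (h : T -> U) :
  continuous h -> measurable_fun setT (h : borel T -> borel U).
Proof.
move=> ch; apply: (@measurability _ _ (borel T) (borel U) _ _ (@open U)) => // _ [A oA <-].
rewrite setTI; apply: sub_sigma_algebra; apply: open_comp => // x _; exact: ch.
Qed.

Section transport.
Context (R : realType) (E : normedModType R) (Delta : set E)
  (Delta0 : Delta !=set0).
Local Notation D := (uset Delta0).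

Lemma continuous_udist : continuous (fun z : D * D => @udist R E Delta z.1 z.2).
Proof.
move=> z; rewrite /udist; apply: cvg_norm; apply: cvgB.
  apply: continuous_comp; first exact: cvg_fst.
  exact: (@initial_continuous _ _ (set_val : Delta -> E)).
apply: continuous_comp; first exact: cvg_snd.
exact: (@initial_continuous _ _ (set_val : Delta -> E)).
Qed.

Lemma measurable_udist :
  measurable_fun setT (fun z : borel (D * D)%type => @udist R E Delta z.1 z.2).
Proof.
apply: (@measurability _ _ (borel (D * D)%type) _ _ _ (@RGenOInfty.G R)).
  exact: RGenOInfty.measurableE.
move=> _ [_ [a ->] <-]; rewrite setTI; apply: sub_sigma_algebra.
apply: open_comp; first by move=> z _; exact: continuous_udist.
exact: interval_open.
Qed.

Lemma wasserstein1_ge0 (P Q : probability (borel D) R) :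
  (0 <= wasserstein1 P Q)%E.
Proof.
apply: le_ereal_inf_tmp => _ [pi _ <-]; apply: integral_ge0 => z _.
by rewrite lee_fin /udist.
Qed.

(** Under a coupling, a pair whose first point is in S has its second point in X
    unless the two are more than r apart, which has probability at most the
    cost divided by r, by Markov's inequality. *)
Lemma wasserstein1_le_sets (P Q : probability (borel D) R) (S X : set (borel D)) (rho r : R) :
  measurable S -> measurable X -> 0 < r ->
  (forall eta xi, S eta -> udist xi eta <= r -> X xi) ->
  (wasserstein1 P Q <= rho%:E)%E -> (P S <= Q X + (rho / r)%:E)%E.
Proof.
move=> mS mX r0 SX PQ.
have fPS := fin_num_measure P _ mS; have fQX := fin_num_measure Q _ mX.
suff : ((r * (fine (P S) - fine (Q X)))%:E <= wasserstein1 P Q)%E.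
  move=> /le_trans/(_ PQ); rewrite lee_fin -(fineK fPS) -(fineK fQX) lee_fin.
  by rewrite -lerBlDl ler_pdivlMr// mulrC.
apply: le_ereal_inf_tmp => _ [pi cpi <-].
pose u (z : borel (D * D)%type) : \bar R := (udist z.1 z.2)%:E.
pose W := [set z | (r%:E <= `|u z|)%E].
have mu : measurable_fun setT u by apply/measurable_EFinP; exact: measurable_udist.
have mW : measurable W.
  rewrite -[X in measurable X]setTI.
  by apply: emeasurable_fun_c_infty => //; exact: measurableT_comp.
have cfst : continuous (@fst D D) by move=> z; exact: cvg_fst.
have csnd : continuous (@snd D D) by move=> z; exact: cvg_snd.
have m1 : measurable (S `*` setT : set (borel (D * D)%type)).
  have := continuous_measurable_borel cfst.
  move=> /(_ measurableT S mS); rewrite setTI; congr measurable.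
  by apply/seteqP; split => -[x y] //= [].
have m2 : measurable (setT `*` X : set (borel (D * D)%type)).
  have := continuous_measurable_borel csnd.
  move=> /(_ measurableT X mX); rewrite setTI; congr measurable.
  by apply/seteqP; split => -[x y] //= [].
have H : (r%:E * pi W <= \int[pi]_z `|u z|)%E.
  have := @le_integral_comp_abse _ _ _ pi setT measurableT u r id.
  by rewrite setTI; apply => //; exact: measurable_id.
have piW := fin_num_measure pi _ mW.
apply: (@le_trans _ _ (r%:E * pi W)%E); last first.
  rewrite (le_trans H)// le_eqVlt; apply/orP; left; apply/eqP.
  by apply: eq_integral => z _; rewrite gee0_abs// lee_fin /udist.
rewrite -(fineK piW) lee_fin ler_pM2l// lerBlDl -lee_fin EFinD !fineK//.
rewrite -(cpi S mS).1 -(cpi X mX).2.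
apply: (@le_trans _ _ (pi ((setT `*` X) `|` W))).
  apply: le_measure; rewrite ?inE//; first exact: measurableU.
  move=> [eta xi]/= [Seta _].
  have [ur|ru] := leP (udist eta xi) r.
    left; split => //; apply: SX Seta _; by rewrite /udist distrC.
  by right; rewrite /W /u /= lee_fin (le_trans (ltW ru))// ler_norm.
exact: measureU2.
Qed.

End transport.

(** * Relaxed scenario problems *)

Section scenario_regions.
Context (R : realType) (E : normedModType R) (Delta : set E)
  (Delta0 : Delta !=set0) (d N : nat).
Local Notation D := (borel (uset Delta0)).
Context (g : 'cV[R]_d -> R) (f : 'cV[R]_d -> D -> R) (r : 'I_N -> R).
Implicit Types (J : {set 'I_N}) (eta : N.-tuple D).

Lemma robust_constraintP (s : R) (eta : D) x :
  robust_constraint_set f s eta x <->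
  forall xi : D, udist xi eta <= s -> f x xi <= 0.
Proof.
split=> [Hx xi xis|Hx].
  rewrite -lee_fin; apply: le_trans Hx.
  by apply: ereal_sup_ubound; exists xi.
by apply: ge_ereal_sup => _ [xi /= xis <-]; rewrite lee_fin Hx.
Qed.

Definition partial_region J eta : set 'cV[R]_d :=
  [set x | g x <= 0] `&`
  [set x | forall i, i \in J -> robust_constraint_set f (r i) (tnth eta i) x].

Lemma RSP_regionE eta : RSP_region g f r eta = partial_region [set: 'I_N]%SET eta.
Proof.
apply/seteqP; split=> x [gx Hx]; split => //.
  by move=> i _; exact: Hx.
by move=> i _; apply: Hx; rewrite finset.in_setT.
Qed.

Lemma partial_region_sublevel J eta : partial_region J eta =
  sublevel [set h | h = g \/ exists i (xi : D),
    [/\ i \in J, udist xi (tnth eta i) <= r i & h = f^~ xi]].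
Proof.
apply/seteqP; split=> x.
  move=> [gx Hx] h [->//|[i [xi [iJ xiJ ->]]]].
  by move/robust_constraintP : (Hx i iJ); exact.
move=> Hx; split; first by apply: (Hx g); left.
move=> i iJ; apply/robust_constraintP => xi xiJ.
by apply: (Hx (f^~ xi)); right; exists i, xi.
Qed.

Lemma measurable_partial_region J x :
  (forall i x, measurable [set eta | robust_constraint_set f (r i) eta x]) ->
  measurable [set eta | partial_region J eta x].
Proof.
move=> mXr.
have -> : [set eta | partial_region J eta x] = [set _ | g x <= 0] `&`
    [set eta : N.-tuple D | forall i, i \in J -> robust_constraint_set f (r i) (tnth eta i) x].
  by apply/seteqP; split.
apply: measurableI; first exact: measurable_prop.
apply: measurable_forall => i; apply: measurable_imply; first exact: measurable_prop.
have := @measurable_tnth _ D N i measurableT _ (mXr i x).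
by rewrite setTI.
Qed.

Context (cg : convex_function setT g)
  (cf : forall xi, convex_function setT (fun x => f x xi)).

Let cfam J eta h : [set h | h = g \/ exists i (xi : D),
    [/\ i \in J, udist xi (tnth eta i) <= r i & h = f^~ xi]] h ->
  convex_function setT h.
Proof. by move=> [->//|[i [xi [_ _ ->]]]]. Qed.

Lemma convex_partial_region J eta : convex_set (partial_region J eta).
Proof. by rewrite partial_region_sublevel; apply: convex_sublevel; exact: cfam. Qed.

Lemma closed_partial_region J eta :
  (partial_region J eta)° !=set0 -> closed (partial_region J eta).
Proof. by rewrite partial_region_sublevel; apply: closed_sublevel; exact: cfam. Qed.

Lemma partial_region_sub eta J : RSP_region g f r eta `<=` partial_region J eta.
Proof.
by rewrite RSP_regionE => x [gx Hx]; split => // i _; apply: Hx; rewrite finset.in_setT.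
Qed.

(** The optimal solution is undominated for the lexicographic preference because
    a point of equal cost would be a second optimal solution; Helly's theorem
    does the rest. *)
Lemma support_exists c eta x : (d <= N)%N ->
  is_solution c (RSP_region g f r eta) x ->
  (forall y, is_solution c (RSP_region g f r eta) y -> y = x) ->
  exists J, #|J| = d /\
    forall y, partial_region J eta y -> ~ preferred c y x.
Proof.
move=> dN solx uniqx; have [[gx Hx] xmin] := solx.
have [| | | |J [Jd Jx]] := @helly_support R d N c [set x | g x <= 0]
    (fun i => robust_constraint_set f (r i) (tnth eta i)) x dN _ _ gx.
- rewrite (_ : [set x | g x <= 0] = partial_region finset.set0 eta).
    exact: convex_partial_region.
  by apply/seteqP; split => [y gy|y []//]; split => // i; rewrite finset.in_set0.
- move=> i; apply/convex_setP => t y z t01 /robust_constraintP Hy /robust_constraintP Hz.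
  apply/robust_constraintP => xi xii.
  rewrite (le_trans (convex_functionP (cf xi) _ _ t01))//.
  move/andP : t01 => [t0 t1].
  by rewrite -[leRHS]addr0 lerD// mulr_ge0_le0// ?subr_ge0// ?Hy ?Hz.
- by move=> i; exact: Hx.
- move=> y gy Hy.
  have Ry : RSP_region g f r eta y by split => // i _; exact: Hy.
  case=> [|[yx sq]]; first by rewrite ltNge xmin.
  have yE : y = x by apply: uniqx; split => // z /xmin; exact: le_trans.
  by rewrite yE ltxx in sq.
- by exists J; split => // y [gy Hy]; exact: Jx.
Qed.

End scenario_regions.


(** The radius of the robust constraint is exactly the displacement that
    [wasserstein1_le_sets] tolerates. *)
Lemma robust_violation_le (R : realType) (E : normedModType R) (Delta : set E)
    (Delta0 : Delta !=set0) (d : nat)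
    (f : 'cV[R]_d -> borel (uset Delta0) -> R)
    (P Q : probability (borel (uset Delta0)) R) (rho r eps : R) (x : 'cV[R]_d) :
  measurable_fun setT (f x) ->
  measurable [set eta | robust_constraint_set f r eta x] -> 0 < r ->
  (wasserstein1 P Q <= rho%:E)%E -> (eps%:E < violation Q f x)%E ->
  (P [set eta | robust_constraint_set f r eta x] <= (1 - eps + rho / r)%:E)%E.
Proof.
move=> mf mX r0 PQ eV.
have mS : measurable [set xi | constraint_set f xi x].
  have := mf measurableT _ (measurable_itv `]-oo, 0]); rewrite setTI.
  by congr measurable; apply/seteqP; split => xi; rewrite /= in_itv.
rewrite EFinD; apply: le_trans (wasserstein1_le_sets mX mS r0 _ PQ) _.
  by move=> eta xi /robust_constraintP; exact.
rewrite leeD2r//; move: eV; rewrite /violation.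
have -> : [set xi | ~ constraint_set f xi x] = ~` [set xi | constraint_set f xi x] by [].
rewrite probability_setC// -(fineK (fin_num_measure Q _ mS)).
by rewrite -EFinB !lte_fin lee_fin => ?; lra.
Qed.


(** * The violation bound *)

(** The exponent k * (t - eps) given by 1 + u <= exp u is at most the one on the
    right.  The inequality between exponents is strict unless t = 0, and in
    that case 1 - eps < exp (- eps) provides strictness. *)
Lemma pow_lt_expR (R : realType) (k : nat) (t eps : R) :
  (0 < k)%N -> 0 <= t -> 0 < eps < 1 ->
  (1 - eps + t) ^+ k < expR (t * (k%:R + 1) - eps).
Proof.
move=> k0 t0 /andP[e0 e1].
have k1 : 1 <= k%:R :> R by rewrite ler1n.
have b0 : 0 <= 1 - eps + t by lra.
have bE : 1 - eps + t = 1 + (t - eps) by ring.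
have [t00|tn0] := eqVneq t 0.
  apply: (@lt_le_trans _ _ (expR (- eps) ^+ k)).
    rewrite ltrXn2r -?lt0n// ?expR_ge0// t00 addr0.
    by rewrite expR_gt1Dx// oppr_eq0 gt_eqF.
  rewrite -expRM_natl ler_expR t00 mul0r sub0r mulr_natl -mulr_natr.
  nra.
apply: (@le_lt_trans _ _ (expR (t - eps) ^+ k)).
  by rewrite lerXn2r ?nnegrE ?expR_ge0// bE expR_ge1Dx.
have tpos : 0 < t by rewrite lt_def tn0.
rewrite -expRM_natl ltr_expR mulr_natl -mulr_natr; nra.
Qed.

Lemma inf_range_gt0 (R : realType) (N : nat) (r : 'I_N -> R) (i0 : 'I_N) :
  (forall i, 0 < r i) -> 0 < inf (range r) /\ forall i, inf (range r) <= r i.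
Proof.
move=> r0; have [i _ imin] := arg_minP r (erefl (xpredT i0)).
have lb : lbound (range r) (r i) by move=> _ [j _ <-]; exact: imin.
split; last by move=> j; apply: ge_inf; [exists (r i)|exists j].
by apply: (lt_le_trans (r0 i)); apply: lb_le_inf => //; exists (r i0), i0.
Qed.

Theorem theorem1 (R : realType) (E : normedModType R) (Delta : set E)
    (Delta0 : Delta !=set0) (d N : nat) (hdN : (d < N)%N)
    (c : 'cV[R]_d) (g : 'cV[R]_d -> R)
    (f : 'cV[R]_d -> borel (uset Delta0) -> R)
    (P : 'I_N.+1 -> probability (borel (uset Delta0)) R)
    (rho : R) (r : 'I_N -> R) (eps : R)
    (xRS : N.-tuple (borel (uset Delta0)) -> 'cV[R]_d)
    (* the measurability needed for the probabilities to be defined *)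
    (mf : forall x, measurable_fun setT (f x))
    (mXr : forall i x, measurable [set eta | robust_constraint_set f (r i) eta x])
    (mV : measurable_fun setT (fun eta => violation (P ord_max) f (xRS eta)))
    (modelA : forall i j, (wasserstein1 (P i) (P j) <= rho%:E)%E)
    (heps : 0 < eps < 1)
    (hr : forall i, 0 < r i)
    (assumption1 : forall eta : N.-tuple (borel (uset Delta0)),
       well_posed c (SP_region g f eta) /\ well_posed c (RSP_region g f r eta))
    (assumption2 : convex_function setT g /\
       forall xi, convex_function setT (fun x => f x xi))
    (hxRS : forall eta, is_solution c (RSP_region g f r eta) (xRS eta)) :
  (prod_probability (fun i : 'I_N => P (widen_ord (leqnSn N) i))
     [set eta | (eps%:E < violation (P ord_max) f (xRS eta))%E]
   < ('C(N, d)%:R *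
      expR (rho * (N%:R + 1 - d%:R) / inf (range r) - eps))%:E)%E.
Proof.
case: assumption2 => cg cf.
have uniqx eta y : is_solution c (RSP_region g f r eta) y -> y = xRS eta.
  have [_ [_ _ [z [_ zu]]]] := assumption1 eta.
  by move=> /zu <-; exact/zu/hxRS.
have solid eta : (RSP_region g f r eta)° !=set0 by have [_ []] := assumption1 eta.
have solidJ eta J : (partial_region g f r J eta)° !=set0.
  by apply: subset_nonempty (solid eta); apply: interiorS; exact: partial_region_sub.
have testP J eta : (exists y, partial_region g f r J eta y /\ preferred c y (xRS eta)) <->
    improvement_test c (RSP_region g f r eta) (partial_region g f r J eta).
  apply: exists_preferredP => //.
  - by rewrite RSP_regionE; exact: convex_partial_region.
  - by rewrite RSP_regionE; apply: closed_partial_region => //; rewrite -RSP_regionE.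
  - exact: convex_partial_region.
  - exact: closed_partial_region.
  - exact: partial_region_sub.
  - exact: uniqx.
pose A := [set eta | (eps%:E < violation (P ord_max) f (xRS eta))%E].
have mA : measurable A.
  by rewrite -[X in measurable X]setTI; exact: emeasurable_fun_o_infty.
(* B J: a large violation, with no point of the region relaxed to J preferred
   to the solution, expressed through the measurable test. *)
pose B (J : {set 'I_N}) := A `\`
  [set eta | improvement_test c (RSP_region g f r eta) (partial_region g f r J eta)].
have mB J : measurable (B J).
  apply: measurableD => //; apply: measurable_improvement_test => x.
    rewrite (_ : [set _ | _] = [set eta | partial_region g f r [set: 'I_N]%SET eta x]).
      exact: measurable_partial_region.
    by apply/seteqP; split => eta /=; rewrite RSP_regionE.
  exact: measurable_partial_region.
have N0 : (0 < N)%N by rewrite (leq_ltn_trans _ hdN).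
have [rmin0 rmin] := inf_range_gt0 (Ordinal N0) hr.
set rm := inf (range r) in rmin0 rmin *.
have rho0 : 0 <= rho.
  by rewrite -lee_fin (le_trans (wasserstein1_ge0 _ _) (modelA ord0 ord0)).
pose t := rho / rm.
have t0 : 0 <= t by rewrite divr_ge0// ltW.
pose b := 1 - eps + t.
have b0 : 0 <= b by move: heps => /andP[]; rewrite /b; lra.
set PN := prod_probability _.
have PB (J : {set 'I_N}) : #|J| = d -> (PN (B J) <= (b ^+ (N - d))%:E)%E.
  move=> Jd; have -> : b ^+ (N - d) = \prod_(i | i \notin J) b.
    rewrite prodr_const; congr (_ ^+ _).
    by apply/eqP; rewrite -(eqn_add2l d) subnKC ?(ltnW hdN)// -Jd cardC card_ord.
  apply: prod_probability_le => // eta j [Aeta ntest] jJ.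
  exists [set s | robust_constraint_set f (r j) s (xRS eta)]; split => //.
    apply: (le_trans (robust_violation_le (mf _) (mXr j _) (hr j) (modelA _ _) Aeta)).
    by rewrite lee_fin /b lerD2l /t ler_wpM2l// lef_pV2// posrE.
  move=> eta' [Aeta' ntest'] agree.
  have pE : partial_region g f r J eta' = partial_region g f r J eta.
    by apply/seteqP; split => x [gx Hx]; split => // i iJ;
      have := Hx i iJ; rewrite agree.
  (* Both solutions are undominated in the same relaxed region. *)
  have -> : xRS eta = xRS eta'.
    apply: (preferred_min_unique (c := c) (C := partial_region g f r J eta)).
    - exact: convex_partial_region.
    - by apply: partial_region_sub; have [] := hxRS eta.
    - by rewrite -pE; apply: partial_region_sub; have [] := hxRS eta'.
    - by move=> z Cz zx; apply: ntest; apply/testP; exists z.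
    - by move=> z Cz zx; apply: ntest'; apply/testP; exists z; rewrite pE.
  by have [[_ Hx] _] := hxRS eta'; exact: Hx.
have AB eta : A eta -> exists2 J : {set 'I_N}, #|J| == d & B J eta.
  move=> Aeta; have [J [Jd Jx]] := support_exists cg cf (ltnW hdN) (hxRS eta) (@uniqx eta).
  exists J; first exact/eqP.
  by split => // /testP[y [/Jx]].
apply: (le_lt_trans (measure_finite_union PN mA mB AB)).
apply: (@le_lt_trans _ _ (\sum_(J : {set 'I_N} | #|J| == d) (b ^+ (N - d))%:E)%E).
  by apply: lee_sum => J /eqP; exact: PB.
rewrite sumEFin lte_fin.
have -> : \sum_(J : {set 'I_N} | #|J| == d) b ^+ (N - d) =
    'C(N, d)%:R * b ^+ (N - d).
  have -> : 'C(N, d) = #|[set J : {set 'I_N} | #|J| == d]%SET|.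
    by rewrite card_draws card_ord.
  rewrite mulr_natl -sumr_const.
  by apply: eq_bigl => J; rewrite inE.
rewrite ltr_pM2l ?ltr0n ?bin_gt0 ?(ltnW hdN)//.
have -> : rho * (N%:R + 1 - d%:R) / rm - eps = t * ((N - d)%:R + 1) - eps.
  by rewrite natrB ?(ltnW hdN)// /t; ring.
by apply: pow_lt_expR; rewrite ?subn_gt0.
Qed.
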